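(* Let $q$ be a power of a prime number such that $q+1=4\pi$ for some prime $\pi>2$. Let $f(x)=x^2+bx+c\in\mathbb{F}_q[x]$ be any irreducible polynomial, where $c$ is a primitive element of $\mathbb{F}_q$. Then $f(x)$ is a primitive polynomial over $\mathbb{F}_q$ if and only if $b^2\neq 2c$. In addition, if $b^2=2c$, then $f(x)$ is an irreducible non-primitive polynomial such that $\mathrm{qord}(f(x))=4$ and $\mathrm{ord}(f(x))=4(q-1)$.
   Context: $\mathbb{F}_q$ denotes the finite field with $q$ elements. A primitive element of $\mathbb{F}_q$ is a generator of the cyclic group $\mathbb{F}_q^*$. A polynomial in $\mathbb{F}_q[x]$ of degree $m\ge 1$ is called a primitive polynomial over $\mathbb{F}_q$ if it is the (monic) minimal polynomial over $\mathbb{F}_q$ of a primitive element of $\mathbb{F}_{q^m}$. For a polynomial $f(x)\in\mathbb{F}_q[x]$ of positive degree with $f(0)\neq 0$: the order $\mathrm{ord}(f(x))$ is the least positive integer $e$ such that $f(x)$ divides $x^e-1$; the quasi-order $\mathrm{qord}(f(x))$ is the least positive integer $\rho$ such that $x^\rho\equiv a \pmod{f(x)}$ for some element $a\in\mathbb{F}_q^*$. *)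

(* Defs.v *)
From HB Require Import structures.
From mathcomp Require Import all_boot all_order all_fingroup all_algebra all_solvable all_field.
Set Implicit Arguments.
Unset Strict Implicit.
Unset Printing Implicit Defensive.
Import GRing.Theory.
Local Open Scope ring_scope.

Definition primitive_elt (K : finFieldType) (a : K) : Prop :=
  exists u : {unit K}, generator [set: {unit K}]%g u /\ val u = a.

(* For a degree m extension L of F (so L is a field with #|F| ^ m elements),
   [finvect_type L] is L with its finite field structure. [minPoly] is always
   monic and has coefficients in L, whence the embedding of [f] into {poly L}.
   The first conjunct forces [f] to have degree m >= 1, as \dim {:L} > 0.
   The library's [qfpoly.primitive_poly] is the characterization by the order
   of 'X modulo [f]; here the definition by minimal polynomials is used. *)
Definition primitive_polynomial (F : finFieldType) (f : {poly F}) : Prop :=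
  exists (L : fieldExtType F) (a : L),
    [/\ \dim {:L} = (size f).-1,
        @primitive_elt (finvect_type L) a
      & map_poly (in_alg L) f = minPoly 1%VS a].

Definition least_positive (P : pred nat) (n : nat) : Prop :=
  [/\ (0 < n)%N, P n & forall m : nat, (0 < m)%N -> P m -> (n <= m)%N].

(* [poly_ord f e] and [poly_qord f r] read "ord(f) = e" and "qord(f) = r";
   they are meant for [f] of positive degree with f(0) != 0, where such an
   [e] and such an [r] exist and are unique. *)
Definition poly_ord (F : finFieldType) (f : {poly F}) (e : nat) : Prop :=
  least_positive (fun n => f %| 'X^n - 1) e.

Definition poly_qord (F : finFieldType) (f : {poly F}) (r : nat) : Prop :=
  least_positive
    (fun n => [exists a : F, (a != 0) && (f %| 'X^n - a%:P)]) r.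

(* Main.v *)
(** Let z be a root of f in F_(q^2). The other root is z^q, so z^(q+1) = c, and
    z^n = 1 forces (q-1) | n because c is primitive. If z^((q-1)m) = 1, then
    4 | m: otherwise c^((q-1)/2) = z^((q-1)2r) = 1. As r is prime, z is hence
    either primitive or of order 4(q-1). The second case means that z^4 is
    fixed by the Frobenius map, and
    z^(4q) - z^4 = (z^q - z)(z^q + z)(z^(2q) + z^2) = - (z^q - z) b (b^2 - 2c),
    where b = 0 is excluded since then z^(2(q-1)) = 1. *)
Require Import Defs.
From HB Require Import structures.
From mathcomp Require Import all_boot all_order all_fingroup all_algebra all_solvable all_field.
From mathcomp Require Import ring zify.
Import GRing.Theory.
Local Open Scope ring_scope.

(** Recasts generators as roots of unity, so that later orders are computed by divisibility of
    exponents. *)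
Lemma primitive_eltE (K : finFieldType) (a : K) :
  primitive_elt a <-> (#|K|.-1).-primitive_root a.
Proof.
have val_exp (u : {unit K}) (x : K) n : val u = x ->
    (x ^+ n == 1) = (#[u]%g %| n)%N.
  by move=> <-; rewrite order_dvdn -val_eqE /= FinRing.val_unitX.
have K1_gt0 : (0 < #|K|.-1)%N by rewrite -card_finField_unit cardG_gt0.
split=> [[u [gen_u Da]] | prim_a].
  have ou : #[u]%g = #|K|.-1.
    by rewrite -card_finField_unit; move/eqP: gen_u => ->.
  rewrite /primitive_root_of_unity K1_gt0; apply/forallP=> i.
  rewrite unity_rootE (val_exp u) // ou; apply/eqP.
  (* The exponent [i.+1] is at most [#|K|.-1], so it is a multiple of it only when equal to it. *)
  have lt_i := ltn_ord i; apply/idP/eqP => [|->] // /dvdn_leq ?; lia.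
have a_unit : a \is a GRing.unit.
  by rewrite -(unitrX_pos _ K1_gt0) (prim_expr_order prim_a) unitr1.
exists (FinRing.unit K a_unit); split=> //.
rewrite /generator eq_sym eqEcard subsetT card_finField_unit /=.
apply: dvdn_leq; first exact: order_gt0.
by rewrite (prim_order_dvd prim_a) (val_exp (FinRing.unit K a_unit)).
Qed.

Lemma primitive_elt_finvect (F : finFieldType) (L : fieldExtType F) (a : L) :
  @primitive_elt (finvect_type L) a <->
  ((#|F| ^ \dim {:L}).-1).-primitive_root a.
Proof.
rewrite primitive_eltE.
have <- // : #|finvect_type L| = (#|F| ^ \dim {:L})%N.
by have := card_vspace {: finvect_type L}; rewrite card_vspacef.
Qed.

(** The minimal polynomial descends to a nonconstant [g] over [F] dividing [f]; irreducibility makes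
    [g] and [f] associate, and both are monic. *)
Lemma minPoly_irreducible {F : fieldType} {L : fieldExtType F} {f : {poly F}}
    {z : L} :
  irreducible_poly f -> f \is monic -> root (map_poly (in_alg L) f) z ->
  minPoly 1%VS z = map_poly (in_alg L) f.
Proof.
move=> irr_f mon_f fz0.
have /polyOver1P[g Dg] := minPolyOver 1%AS z.
have g_dvd_f : g %| f.
  rewrite -(dvdp_map (in_alg L)) -Dg minPoly_dvdp //.
  by apply/polyOver1P; exists f.
have sz_g : size g != 1%N.
  by rewrite -(size_map_poly (in_alg L)) -Dg size_minPoly.
have mon_g : g \is monic by rewrite -(map_monic (in_alg L)) -Dg monic_minPoly.
rewrite Dg; congr map_poly; apply/eqP.
by rewrite -eqp_monic //; apply: (apply_irredp irr_f).
Qed.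

(** Turns divisibility of ['X^n - a%:P] by [f] into [z ^+ n = a%:A], from which ord and qord are
    computed. *)
Lemma dvdp_root {F : fieldType} {L : fieldExtType F} {f : {poly F}} {z : L} g :
  irreducible_poly f -> f \is monic -> root (map_poly (in_alg L) f) z ->
  (f %| g) = root (map_poly (in_alg L) g) z.
Proof.
move=> irr_f mon_f fz0; apply/idP/idP => [/dvdpP[h ->] | gz0].
  by rewrite rmorphM rootM fz0 orbT.
rewrite -(dvdp_map (in_alg L)) -(minPoly_irreducible irr_f mon_f fz0).
by rewrite minPoly_dvdp //; apply/polyOver1P; exists g.
Qed.

Section Quadratic.

Context {F : finFieldType} {L : fieldExtType F} {b c : F} {z : L}.
Let q := #|F|.
Let f : {poly F} := 'X^2 + b *: 'X + c%:P.

Lemma size_quadratic : size f = 3.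
Proof.
rewrite /f -addrA size_polyDl ?size_polyXn // -mul_polyC size_MXaddC.
by case: ifP => // _; rewrite !ltnS size_polyC leq_b1.
Qed.

Lemma monic_quadratic : f \is monic.
Proof.
by rewrite monicE /lead_coef size_quadratic /f !coefE /= mulr0 !addr0.
Qed.

Lemma root_quadratic y :
  root (map_poly (in_alg L) f) y = (y ^+ 2 + b%:A * y + c%:A == 0).
Proof.
by rewrite rootE /f !rmorphD /= map_polyZ /= map_polyX map_polyXn map_polyC
   !hornerE.
Qed.

Lemma frobeniusD (x y : L) : (x + y) ^+ q = x ^+ q + y ^+ q.
Proof.
have [p pr_p chFp] := finPcharP F.
have chLp : p \in [pchar L] by rewrite pchar_lalg.
(* [q] is a power of the characteristic, as the additive group of [F] is an elementary abelian
   p-group. *)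
apply: exprDn_pchar; rewrite (eq_pnat _ (pcharf_eq chLp)) /q -cardsT.
exact: abelem_pgroup (fin_ring_pchar_abelem chFp).
Qed.

Lemma mem1v_frobenius (x : L) : (x \in 1%VS) = (x ^+ q == x).
Proof. by rewrite (Fermat's_little_theorem 1%AS) dimv1 expn1. Qed.

(** Frobenius fixes [F], so it sends [z] to a root of [f]; it moves [z] because [f] has no root in
    [F]. Vieta's formulas follow. *)
Lemma quadratic_conj :
    irreducible_poly f -> root (map_poly (in_alg L) f) z ->
  [/\ z ^+ q != z, z ^+ q + z = - b%:A & z ^+ q * z = c%:A].
Proof.
move=> irr_f fz0; have alg_q (a : F) : (a%:A : L) ^+ q = a%:A.
  by rewrite -(rmorphXn (in_alg L)) /= expf_card.
have z_neq : z ^+ q != z.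
  rewrite -mem1v_frobenius; apply/vlineP=> -[a Dz].
  have fa0 : root f a by move: fz0; rewrite Dz (fmorph_root (in_alg L)).
  have := size_quadratic; rewrite -(eqp_size (irr_f.2 ('X - a%:P) _ _)).
  - by rewrite size_XsubC.
  - by rewrite size_XsubC.
  - by rewrite dvdp_XsubCl.
move: fz0; rewrite root_quadratic => /eqP fz.
have fzq : (z ^+ q) ^+ 2 + b%:A * z ^+ q + c%:A = 0.
  rewrite exprAC -(alg_q b) -exprMn -(alg_q c) -!frobeniusD fz.
  by rewrite expr0n /q; case: #|F| (fintype0 (0 : F)) => // ->.
have sum_z : z ^+ q + z = - b%:A.
  apply/eqP; rewrite -subr_eq0 opprK.
  (* Subtracting the equations of [z] and [z ^+ q] leaves the nonzero factor [z ^+ q - z]. *)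
  have /eqP : (z ^+ q - z) * (z ^+ q + z + b%:A) = 0.
    by rewrite -[RHS](subrr 0) -{1}fzq -fz; ring.
  by rewrite mulf_eq0 subr_eq0 (negPf z_neq).
split=> //.
have -> : z ^+ q = - b%:A - z by rewrite -sum_z addrK.
by apply/eqP; rewrite -subr_eq0 -oppr_eq0 -fz; apply/eqP; ring.
Qed.

Lemma quadratic_root_exp4 :
    irreducible_poly f -> root (map_poly (in_alg L) f) z ->
  ((z ^+ 4) ^+ q == z ^+ 4) = (b == 0) || (b ^+ 2 == 2%:R * c).
Proof.
move=> irr_f fz0; have [z_neq sum_z prod_z] := quadratic_conj irr_f fz0.
rewrite -(exprAC z q) -subr_eq0; set y := z ^+ q in z_neq sum_z prod_z *.
have -> : y ^+ 4 - z ^+ 4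
        = (y - z) * (- (b * (b ^+ 2 - 2%:R * c))%:A).
  have -> : (b * (b ^+ 2 - 2%:R * c))%:A
          = b%:A * (b%:A ^+ 2 - 2%:R * c%:A) :> L.
    by rewrite -in_algE rmorphM rmorphB rmorphXn rmorphM rmorph_nat.
  rewrite -prod_z -[b%:A]opprK -sum_z; ring.
rewrite mulf_eq0 subr_eq0 (negPf z_neq) oppr_eq0 scaler_eq0 oner_eq0 orbF.
by rewrite mulf_eq0 subr_eq0.
Qed.

Lemma quadratic_root_order r :
    prime r -> (q + 1 = 4 * r)%N -> (q.-1).-primitive_root c ->
    irreducible_poly f -> root (map_poly (in_alg L) f) z ->
  (q.-1 * (if (b ^+ 2 == 2%:R * c)%R then 4 else 4 * r))%N.-primitive_root z.
Proof.
move=> pr_r Dq prim_c irr_f fz0; have r_gt0 := prime_gt0 pr_r.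
have [_ sum_z prod_z] := quadratic_conj irr_f fz0.
have q_gt0 : (0 < q)%N by lia.
have c_exp n : (z ^+ (q.+1 * n) == 1) = (q.-1 %| n)%N.
  rewrite (prim_order_dvd prim_c) exprM exprSr prod_z.
  by rewrite -in_algE -rmorphXn fmorph_eq1.
have z_neq0 : z != 0.
  apply/eqP=> z0; have := c_exp q.-1; rewrite dvdnn z0 expr0n muln_eq0 /=.
  by rewrite eqn0Ngt (prim_order_gt0 prim_c) eq_sym oner_eq0.
set w := z ^+ q.-1.
have w_4r : w ^+ (4 * r) = 1.
  by apply/eqP; rewrite -exprM -Dq addn1 mulnC c_exp.
have r4_gt0 : (0 < 4 * r)%N by lia.
have [d prim_w d_dvd] := prim_order_exists r4_gt0 w_4r.
have dvd4d : (4 %| d)%N.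
  have : ~~ (d %| 2 * r)%N.
    rewrite (prim_order_dvd prim_w) -exprM.
    (* Here [q.-1] is twice [(2 * r).-1], so [d] dividing [2 * r] would give [c] an order of at most
       [(2 * r).-1], which is too small. *)
    have -> : (q.-1 * (2 * r) = q.+1 * (2 * r).-1)%N by nia.
    by rewrite c_exp; apply/negP => /dvdn_leq; lia.
  (* The cofactor [e] of [d] in [4 * r] is odd, hence prime to 4: an even [e] would make [d] divide
     [2 * r]. *)
  have /dvdnP[e De] := d_dvd; have [odd_e _|even_e] := boolP (odd e).
    have co_4e : coprime 4 e by rewrite (@coprimeXl 2 2) ?coprime2n.
    by rewrite -(Gauss_dvdr d co_4e) -De dvdn_mulr.
  case/negP; apply/dvdnP; exists e./2.
  by have := even_halfK even_e; nia.
have Dw4 : (w ^+ 4 == 1) = (b ^+ 2 == 2%:R * c).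
  have -> : (w ^+ 4 == 1) = ((z ^+ 4) ^+ q == z ^+ 4).
    rewrite -[in RHS](prednK q_gt0) (exprSr (z ^+ 4)) exprAC -/w.
    apply/eqP/eqP=> [-> | w4]; first by rewrite mul1r.
    by apply: (mulIf (expf_neq0 4 z_neq0)); rewrite mul1r.
  (* If [b = 0] then [z ^+ q = - z], so [w = -1] has order dividing 2, although 4 divides [d]. *)
  rewrite quadratic_root_exp4 //; case: eqP => //= b0.
  suff : (d %| 2)%N by move/(dvdn_trans dvd4d).
  rewrite (prim_order_dvd prim_w); apply/eqP.
  have -> : w = -1.
    apply: (mulIf z_neq0); rewrite -exprSr prednK // mulN1r.
    by apply/eqP; rewrite -addr_eq0 sum_z b0 scale0r oppr0.
  by rewrite sqrrN expr1n.
(* [d] is 4 times a divisor of the prime [r], and [w ^+ 4 = 1] decides between 4 and [4 * r]. *)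
have -> : (if (b ^+ 2 == 2%:R * c)%R then 4 else 4 * r)%N = d.
  rewrite -Dw4 -(prim_order_dvd prim_w).
  have [e De] := dvdnP dvd4d; subst d.
  move: d_dvd; rewrite mulnC dvdn_pmul2l // => /(prime_nt_dvdP pr_r) er.
  have [->|e1] := eqVneq e 1%N; first by rewrite dvdnn.
  rewrite er //; case: ifP => // /dvdn_leq; lia.
have q1_gt0 := prim_order_gt0 prim_c; have d_gt0 := prim_order_gt0 prim_w.
have z_d : z ^+ (q.-1 * d) = 1 by rewrite exprM (prim_expr_order prim_w).
have qd_gt0 : (0 < q.-1 * d)%N by rewrite muln_gt0 q1_gt0.
have [n prim_z n_dvd] := prim_order_exists qd_gt0 z_d.
(* The order [n] of [z] is some [m * q.-1] because [c ^+ n = 1]; then [w ^+ m = 1], so [d] divides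
   [m]. *)
suff /eqP <- : n == (q.-1 * d)%N by [].
have /dvdnP[m Dn] : (q.-1 %| n)%N.
  by rewrite -c_exp mulnC exprM (prim_expr_order prim_z) expr1n.
rewrite eqn_dvd n_dvd Dn (mulnC m) dvdn_pmul2l //.
by rewrite /= (prim_order_dvd prim_w) -exprM mulnC -Dn prim_expr_order.
Qed.

End Quadratic.

Theorem theorem7 (p k q r : nat) (F : finFieldType) (b c : F)
    (f := 'X^2 + b *: 'X + c%:P : {poly F}) :
  prime p -> (0 < k)%N -> q = (p ^ k)%N -> #|F| = q ->
  prime r -> (2 < r)%N -> (q + 1 = 4 * r)%N ->
  irreducible_poly f -> primitive_elt c ->
  (primitive_polynomial f <-> b ^+ 2 <> 2%:R * c) /\
  (b ^+ 2 = 2%:R * c ->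
   [/\ irreducible_poly f, ~ primitive_polynomial f,
       poly_qord f 4 & poly_ord f (4 * (q - 1))]).
Proof.
move=> _ _ _ <- pr_r r_gt2 Dq irr_f /primitive_eltE prim_c.
have mon_f : f \is monic := monic_quadratic.
have sz_f : size f = 3 := size_quadratic.
have ord_root (L : fieldExtType F) (z : L) :=
  quadratic_root_order (z := z) _ pr_r Dq prim_c irr_f.
have q1_gt0 := prim_order_gt0 prim_c.
(* A root of order [#|F| ^ 2 - 1] killed by the exponent [4 * (#|F| - 1)] would force
   [#|F| + 1 <= 4], against [2 < r]. *)
have not_prim : b ^+ 2 = 2%:R * c -> ~ primitive_polynomial f.
  move=> /eqP Db [L [a [dimL /primitive_elt_finvect prim_a Df]]].
  have fa0 : root (map_poly (in_alg L) f) a by rewrite Df root_minPoly.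
  have := ord_root L a fa0; rewrite Db => /prim_expr_order/eqP.
  rewrite -(prim_order_dvd prim_a) dimL sz_f /= -mulnn => /dvdn_leq.
  by move: #|F| Dq q1_gt0 => n; nia.
have [L dimL [z fz0 _]] := irredp_FAdjoin irr_f.
have {ord_root} prim_z := ord_root L z fz0.
split=> [|Db]; first split=> [prim_f Db | /eqP/negPf Db].
- exact: not_prim Db prim_f.
- exists L, z; split=> //; last by rewrite (minPoly_irreducible irr_f mon_f fz0).
  apply/primitive_elt_finvect; rewrite dimL sz_f.
  suff -> : (#|F| ^ 2).-1 = (#|F|.-1 * (4 * r))%N by rewrite Db in prim_z.
  by rewrite -Dq -mulnn; nia.
rewrite Db eqxx in prim_z.
have dvd_f := dvdp_root _ irr_f mon_f fz0.
have z4 : z ^+ 4 \in 1%VS.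
  by rewrite mem1v_frobenius (quadratic_root_exp4 irr_f fz0) Db eqxx orbT.
split=> //; first exact: not_prim.
  split=> //.
  - have [a Da] := vlineP _ _ z4.
    apply/existsP; exists a.
    rewrite dvd_f rmorphB /= map_polyXn map_polyC rootE !hornerE /= Da subrr.
    (* [a = 0] would make a power of [z] equal to both 0 and 1. *)
    rewrite eqxx andbT; apply/eqP=> a0; have := prim_expr_order prim_z.
    rewrite mulnC exprM Da a0 scale0r expr0n eqn0Ngt q1_gt0.
    by move/eqP; rewrite eq_sym oner_eq0.
  - move=> m m_gt0 /existsP[a /andP[a_neq0]].
    rewrite dvd_f rmorphB /= map_polyXn map_polyC rootE !hornerE subr_eq0.
    move/eqP=> zm.
    (* Raising [z ^+ m = a%:A] to the power [#|F|.-1] gives 1; cancelling [#|F|.-1] then leaves 4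
       dividing [m]. *)
    have : (#|F|.-1 * 4 %| #|F|.-1 * m)%N.
      rewrite (prim_order_dvd prim_z) mulnC exprM zm -rmorphXn fmorph_eq1.
      rewrite -(inj_eq (mulIf a_neq0)) mul1r -exprSr prednK ?expf_card //.
      by apply/card_gt0P; exists a.
    by rewrite dvdn_pmul2l // => /dvdn_leq; apply.
have dvd_X1 n : (f %| 'X^n - 1) = (4 * (#|F| - 1) %| n)%N.
  rewrite subn1 mulnC (prim_order_dvd prim_z) dvd_f rmorphB rmorph1 /=.
  by rewrite map_polyXn rootE !hornerE subr_eq0.
split=> [||m m_gt0]; rewrite ?dvd_X1 //; first by rewrite subn1 muln_gt0.
exact: dvdn_leq.
Qed.
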